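(* Let $(A_i)_{i=1}^\infty$ be an infinite sequence of events in a probability space with probability measure $\mathbb{P}$. Let $\omega \colon \mathbb{N}^+ \to \mathbb{N}^+$ be such that for all $N \in \mathbb{N}^+$ \[ \sum_{i=1}^{\omega(N)} \mathbb{P}[A_i] \geq N, \] and let $\phi \colon \mathbb{N} \times \mathbb{N} \to \mathbb{N}$ be such that for all $\ell, n \in \mathbb{N}$ \[ \phi(\ell, n) \geq n \quad\text{and}\quad \frac{\sum_{i,k=1}^{\phi(\ell, n)} \mathbb{P}[A_i A_k]}{\left(\sum_{i=1}^{\phi(\ell, n)} \mathbb{P}[A_i]\right)^2} \leq 1 + \frac{1}{2^\ell}. \] Define $n_1 = \phi(1, 1)$ and, for $k > 1$, $n_k = \phi(k, \max(n_{k-1}, k))$. Then, for all $n \in \mathbb{N}^+$ and $\ell \in \mathbb{N}$, \[ \mathbb{P}\left[\bigcup_{i=n}^{n_m} A_i\right] \geq 1 - \frac{1}{2^\ell}, \] where $m = \max(\omega(2n), \ell+3)$.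
   Context: $\mathbb{N}$ denotes the non-negative integers and $\mathbb{N}^+$ the positive integers. $A_i A_k$ denotes the intersection $A_i \cap A_k$, and $\sum_{i,k=1}^{n}$ is the sum over all pairs $(i,k)$ with $1 \le i \le n$ and $1 \le k \le n$. The hypothesis on $\phi$ includes that the displayed quotient is well defined, i.e. that its denominator is nonzero. *)

(* Defs.v *)
From mathcomp Require Import all_boot.

Set Implicit Arguments.
Unset Strict Implicit.
Unset Printing Implicit Defensive.

(* n_1 = phi(1, 1) and n_k = phi(k, max(n_{k-1}, k)) for k > 1; the value at
   k = 0 is a placeholder, and no other value depends on it. *)
Fixpoint index_seq (phi : nat -> nat -> nat) (k : nat) : nat :=
  match k with
  | 0 => 0
  | 1 => phi 1 1
  | k'.+1 => phi k (maxn (index_seq phi k') k)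
  end.

(* Main.v *)
(* Let [M] be the last index, [S] the number of events among [A 1, .., A M] that
   occur, and [s] the mean of [S].  The hypothesis on [phi] bounds the variance
   of [S] by [s ^ 2 / 2 ^ m], and [M >= omega (2 n)] gives [s >= 2 n].  If none of
   [A n, .., A M] occurs then [S <= n <= s / 2], which by Chebyshev's inequality
   has probability at most [4 / 2 ^ m <= 1 / 2 ^ l]. *)

Require Import Defs.
From HB Require Import structures.
From mathcomp Require Import all_boot all_order all_algebra.
From mathcomp Require Import all_classical all_reals all_analysis.
From mathcomp Require Import measurable_realfun.
From mathcomp Require Import ring lra.

Set Implicit Arguments.
Unset Strict Implicit.
Unset Printing Implicit Defensive.

Import Order.TTheory GRing.Theory Num.Theory.
Local Open Scope classical_set_scope.
Local Open Scope ring_scope.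

(** Linearity of expectation for a count of events. It gives the mean of [S] below and, with pairs
    as indices, its second moment. *)
Lemma integral_sum_indic (R : realType) (d : measure_display)
  (T : measurableType d) (P : probability T R) (I : Type) (r : seq I)
  (B : I -> set T) (mB : forall i, measurable (B i)) :
  (\int[P]_x (\sum_(i <- r) \1_(B i) x)%:E =
    (\sum_(i <- r) fine (P (B i)))%:E)%E.
Proof.
under eq_integral do rewrite -sumEFin.
rewrite ge0_integral_sum//; last first.
  by move=> i; apply/measurable_EFinP/measurable_indic.
rewrite EFin_sum_fine => [|i _]; last exact: fin_num_measure.
by apply: eq_bigr => i _; rewrite integral_indic// setIT.
Qed.

(* Integrating [(s - t)^2 1_E <= (S - s)^2], with [S] the number of events that
   occur and [s] its mean; cross terms are moved so that all integrands are
   nonnegative. *)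
Lemma chebyshev_sum_indic (R : realType) (d : measure_display)
  (T : measurableType d) (P : probability T R) (I : Type) (r : seq I)
  (A : I -> set T) (mA : forall i, measurable (A i))
  (E : set T) (mE : measurable E) (t : R) :
  let s := \sum_(i <- r) fine (P (A i)) in
  t <= s ->
  (forall x, E x -> \sum_(i <- r) \1_(A i) x <= t) ->
  (s - t) ^+ 2 * fine (P E) <=
    \sum_(i <- r) \sum_(k <- r) fine (P (A i `&` A k)) - s ^+ 2.
Proof.
move=> s ts SE.
have s0 : 0 <= s by apply: sumr_ge0 => i _; exact/fine_ge0/measure_ge0.
set S := fun x => \sum_(i <- r) (\1_(A i) x : R).
have S0 x : 0 <= S x by exact: sumr_ge0.
have mS : measurable_fun [set: T] S.
  by apply: measurable_sum => i; exact: measurable_indic.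
(* Flattening the double sum over the list of pairs makes [S ^+ 2] again a sum of indicators, namely
   of the intersections. *)
have S2E x : S x ^+ 2 =
    \sum_(p <- [seq (i, k) | i <- r, k <- r]) \1_(A p.1 `&` A p.2) x.
  rewrite big_allpairs expr2 mulr_suml; apply: eq_bigr => i _.
  by rewrite mulr_sumr; apply: eq_bigr => k _; rewrite indicI.
have IS2 : (\int[P]_x (S x ^+ 2)%:E =
    (\sum_(i <- r) \sum_(k <- r) fine (P (A i `&` A k)))%:E)%E.
  under eq_integral do rewrite S2E.
  rewrite integral_sum_indic ?big_allpairs// => p.
  exact: measurableI.
have mE1 : measurable_fun [set: T] (fun x => (\1_E x)%:E : \bar R).
  by apply/measurable_EFinP/measurable_indic.
have mSE : measurable_fun [set: T] (fun x => (S x)%:E) by exact/measurable_EFinP.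
have mS2 : measurable_fun [set: T] (fun x => (S x ^+ 2)%:E).
  by apply/measurable_EFinP; exact: measurable_funX.
have le_int :
    (\int[P]_x (((s - t) ^+ 2)%:E * (\1_E x)%:E + (2 * s)%:E * (S x)%:E) <=
     \int[P]_x ((S x ^+ 2)%:E + cst (s ^+ 2)%:E x))%E.
  apply: ge0_le_integral => //=.
  - move=> x _; rewrite -!EFinM -EFinD lee_fin addr_ge0// mulr_ge0 ?sqr_ge0//.
    by rewrite mulr_ge0.
  - apply: emeasurable_funD; exact: measurable_funeM.
  - exact: emeasurable_funD.
  - move=> x _; rewrite -!EFinM -!EFinD lee_fin indicE.
    (* On [E], [S x <= t <= s] yields [(s - t) ^+ 2 <= (s - S x) ^+ 2]; off [E] the claim is that a
       square is nonnegative. *)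
    case: (boolP (x \in E)) => /= [/set_mem/SE St|_].
      by have := S0 x; rewrite -/(S x) in St *; nra.
    by have := sqr_ge0 (S x - s); nra.
have cS0 x : (0 <= (2 * s)%:E * (S x)%:E)%E by rewrite -EFinM lee_fin !mulr_ge0.
have cE0 x : (0 <= ((s - t) ^+ 2)%:E * (\1_E x)%:E)%E.
  by rewrite -EFinM lee_fin mulr_ge0 ?sqr_ge0.
have S20 x : (0 <= (S x ^+ 2)%:E)%E by rewrite lee_fin sqr_ge0.
have S0' x : (0 <= (S x)%:E)%E by rewrite lee_fin.
have E0 x : (0 <= (\1_E x)%:E :> \bar R)%E by rewrite lee_fin.
have s20 (x : T) : (0 <= cst (s ^+ 2)%:E x)%E by rewrite lee_fin sqr_ge0.
move: le_int; rewrite ge0_integralD//; [|exact: measurable_funeM..].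
rewrite [in leRHS]ge0_integralD//.
rewrite !ge0_integralZl_EFin ?sqr_ge0 ?mulr_ge0//.
rewrite IS2 integral_sum_indic// integral_indic// setIT.
rewrite integral_cst//= probability_setT mule1.
rewrite -[P E]fineK ?fin_num_measure// -!EFinM -!EFinD lee_fin -/s.
nra.
Qed.

Lemma index_seqE (phi : nat -> nat -> nat) (k : nat) : (1 < k)%N ->
  index_seq phi k = phi k (maxn (index_seq phi k.-1) k).
Proof. by case: k => [|[|k]]. Qed.

Theorem theorem3p3 (R : realType) (d : measure_display)
  (T : measurableType d) (P : probability T R)
  (A : nat -> set T)
  (mA : forall i : nat, (1 <= i)%N -> measurable (A i))
  (omega : nat -> nat)
  (omega_pos : forall N : nat, (1 <= N)%N -> (1 <= omega N)%N)
  (omega_sum : forall N : nat, (1 <= N)%N ->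
     N%:R <= \sum_(1 <= i < (omega N).+1) fine (P (A i)))
  (phi : nat -> nat -> nat)
  (phi_ge : forall l n : nat, (n <= phi l n)%N)
  (phi_den : forall l n : nat,
     (\sum_(1 <= i < (phi l n).+1) fine (P (A i))) ^+ 2 != 0)
  (phi_quot : forall l n : nat,
     (\sum_(1 <= i < (phi l n).+1) \sum_(1 <= k < (phi l n).+1)
         fine (P (A i `&` A k)))
       / (\sum_(1 <= i < (phi l n).+1) fine (P (A i))) ^+ 2
     <= 1 + 1 / 2 ^+ l) :
  forall n l : nat, (1 <= n)%N ->
    let m := maxn (omega (2 * n)%N) (l + 3)%N in
    ((1 - 1 / 2 ^+ l)%:E
       <= P (\bigcup_(i in [set i : nat | (n <= i <= index_seq phi m)%N]) A i))%E.
Proof.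
move=> n l n1 /=; set m := maxn _ _; set M := index_seq phi m.
have m_ge : (l + 3 <= m)%N by exact: leq_maxr.
have ME : M = phi m (maxn (index_seq phi m.-1) m).
  by apply: index_seqE; apply: leq_trans m_ge; rewrite addn3.
(* The maximum with [k] in the recursion, together with [phi_ge], forces [M >= m]. *)
have mM : (omega (2 * n) <= M)%N.
  rewrite (leq_trans (leq_maxl _ (l + 3)%N))// -/m ME.
  exact: leq_trans (leq_maxr _ _) (phi_ge _ _).
set U := \bigcup_(i in _) A i.
have mU : measurable U.
  apply: bigcup_measurable => i /= /andP[ni _]; apply: mA.
  exact: leq_trans ni.
have := phi_quot m (maxn (index_seq phi m.-1) m).
(* Sums are shifted to start at 0: the family [A i.+1] is measurable at every index, as the
   Chebyshev lemma requires, while [A 0] is arbitrary. *)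
rewrite -ME !big_add1 /=; under eq_bigr do rewrite big_add1 /=.
have := phi_den m (maxn (index_seq phi m.-1) m).
rewrite -ME big_add1 /=.
set s := \sum_(0 <= i < M) _ => s2_neq0.
set q := \sum_(0 <= i < M) _ => q_le.
have s_ge : (2 * n)%:R <= s.
  apply: le_trans (omega_sum _ _) _; first by rewrite muln_gt0.
  rewrite big_add1 /= /s [leRHS](big_cat_nat (n := omega (2 * n)))//= lerDl.
  by apply: sumr_ge0 => i _; exact/fine_ge0/measure_ge0.
have n_gt0 : 0 < n%:R :> R by rewrite ltr0n.
rewrite natrM in s_ge.
have cheb : (s - n%:R) ^+ 2 * fine (P (~` U)) <= q - s ^+ 2.
  apply: (@chebyshev_sum_indic _ _ _ P _ (index_iota 0 M) (fun i => A i.+1)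
    (fun i => mA i.+1 isT) (~` U) (measurableC mU));
    first by apply: le_trans s_ge; lra.
  (* Outside [U] only [A 1, .., A n.-1] can occur. *)
  move=> x Ux.
  (* Because of the shift, the cutoff [i < n] retains [A 1, .., A n], so the bound obtained is
     [n]. *)
  apply: (@le_trans _ _ (\sum_(0 <= i < M | (i < n)%N) 1)).
    rewrite [leRHS]big_mkcond /=; apply: ler_sum_nat => i /andP[_ iM].
    rewrite indicE; case: ifPn => [_|]; first by case: (_ \in _).
    rewrite -leqNgt => ni; case: (boolP (_ \in _)) => //= /set_mem Ax.
    by exfalso; apply: Ux; exists i.+1 => //=; rewrite iM leqW.
  rewrite big_const_seq iter_addr_0 ler_nat.
  have -> : count (fun i => (i < n)%N) (index_iota 0 M) =
     size [seq i <- index_iota 0 M | (i < n)%N] by rewrite size_filter.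
  (* A duplicate-free list of naturals below [n] has at most [n] entries, so [n] and [M] need not be
     compared. *)
  rewrite -[leqRHS](size_iota 0); apply: uniq_leq_size.
    by rewrite filter_uniq// iota_uniq.
  by move=> i; rewrite mem_filter mem_iota add0n => /andP[].
have PC : fine (P (~` U)) = 1 - fine (P U).
  by rewrite probability_setC// -[P U]fineK ?fin_num_measure.
rewrite -[P U]fineK ?fin_num_measure// lee_fin.
(* The factor 4 compensates for the loss in [(s - n) ^+ 2 >= s ^+ 2 / 4]. *)
have e_le : 1 / 2 ^+ m <= (1 / 2 ^+ l) / 4 :> R.
  have -> : 1 / 2 ^+ l / 4 = 1 / 2 ^+ (l + 2) :> R.
    by rewrite exprD !div1r -invfM expr2 -natrM.
  rewrite !div1r lef_pV2 ?posrE ?exprn_gt0// ler_eXn2l ?ltr1n//.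
  by rewrite (leq_trans _ m_ge)// leq_add2l.
have s2_gt0 : 0 < s ^+ 2 by rewrite lt0r s2_neq0 sqr_ge0.
move: q_le; rewrite ler_pdivrMr// => q_le.
have PU0 : 0 <= fine (P (~` U)) by exact/fine_ge0/measure_ge0.
rewrite PC in cheb PU0.
move: e_le q_le; set e := 1 / 2 ^+ m; set e' := 1 / 2 ^+ l => e_le q_le.
(* With [p] the probability of the complement of [U], the chain is [s ^+ 2 / 4 * p <= (s - n) ^+ 2 *
   p <= q - s ^+ 2 <= s ^+ 2 * e <= s ^+ 2 * e' / 4]. *)
have : s ^+ 2 * (1 - fine (P U)) <= s ^+ 2 * e'.
  have half : s ^+ 2 / 4 <= (s - n%:R) ^+ 2 by nra.
  have := ler_wpM2r PU0 half.
  have := ler_wpM2l (ltW s2_gt0) e_le.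
  by lra.
rewrite ler_pM2l//; lra.
Qed.
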